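(* Let $X$ be a nonempty set, let $S$ be an equivalence relation on $X$ and let $\preceq$ be a partial order on $X$. Then the following statements are equivalent: (i) there exists a total preorder $S$-extension of $\preceq$; (ii) the composition $S \circ P_\preceq \circ S$ is acyclic.
   Context: Binary relations on $X$ are subsets of $X\times X$. A preorder is a reflexive and transitive relation; a partial order is an antisymmetric preorder. A relation $G$ is total if for all $x,y\in X$ we have $(x,y)\in G$ or $(y,x)\in G$. For a binary relation $G$, its asymmetric part is $P_G=\{(x,y)\in G : (y,x)\notin G\}$ and its symmetric part is $S_G=\{(x,y)\in G : (y,x)\in G\}$. Composition: $G\circ H=\{(x,y) : \exists z\in X,\ (x,z)\in G \text{ and } (z,y)\in H\}$. Given a partial order $\preceq$ and an equivalence relation $S$ on $X$, a total preorder $S$-extension of $\preceq$ is a total preorder $\precsim$ on $X$ such that $P_\preceq\subset P_\precsim$ and $S_\precsim=S$. A binary relation $G$ on $X$ is acyclic if for any finite collection $x_1,\dots,x_n\in X$, the conditions $(x_i,x_{i+1})\in G$ for $i=1,\dots,n-1$ imply $(x_n,x_1)\notin G$. The symbol $\subset$ denotes non-strict inclusion. *)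

(* Defs.v *)
From Stdlib Require Export Relations.
Set Implicit Arguments.

Section Defs.
Variable X : Type.
Implicit Types G H S : relation X.

Definition total G : Prop := forall x y, G x y \/ G y x.

Definition asym_part G : relation X := fun x y => G x y /\ ~ G y x.

Definition sym_part G : relation X := fun x y => G x y /\ G y x.

Definition rel_comp G H : relation X := fun x y => exists z, G x z /\ H z y.

(* The finite collection x_1, ..., x_n (n >= 1) is given by the values at
   1, ..., n of a sequence; the case n = 1 says that G is irreflexive. *)
Definition acyclic G : Prop :=
  forall (n : nat) (x : nat -> X), 1 <= n ->
    (forall i, 1 <= i < n -> G (x i) (x (i + 1))) -> ~ G (x n) (x 1).

Definition total_preorder G : Prop := preorder X G /\ total G.

(* Equality of relations is extensional. *)
Definition total_preorder_extension S (le T : relation X) : Prop :=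
  total_preorder T
  /\ inclusion X (asym_part le) (asym_part T)
  /\ same_relation X (sym_part T) S.

End Defs.

(* Main.v *)
Require Import Defs.
From Stdlib Require Import Arith Lia Classical.
From mathcomp Require boolp classical_sets.

Set Implicit Arguments.

(** Write [B] for the composition of [S], the asymmetric part of [le], and [S]
    again.

    If [T] is a total preorder [S]-extension, every [B]-step is a strict
    [T]-step, because the two [S]-steps are [T]-indifferences. Along a [B]-chain
    [T] therefore can only go up, and a closing [B]-step would strictly go down
    again ([strict_in_preorder_acyclic]).

    Conversely, let [B] be acyclic, so that its transitive closure [B+] is
    irreflexive ([acyclic_clos_trans_irrefl]). Since [B] absorbs [S] on both
    sides, so does [B+], and the union of [S] and [B+] is a preorder. Two
    elements related both ways by it are [S]-equivalent, for otherwise [B+]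
    would relate some element to itself; so its symmetric part is exactly [S]
    ([sym_part_composed_preorder]), and the asymmetric part of [le], which is
    included in [B] and disjoint from [S] ([composition_acyclic_disjoint]), lies
    in its asymmetric part. It remains to make this preorder total without
    creating new indifferences: this is Szpilrajn's theorem for preorders
    ([total_preorder_refinement]). By Zorn's lemma there is a maximal preorder
    among those containing the given one with the same symmetric part, and
    a maximal one is total because an incomparable pair could be added
    ([add_pair]). *)

(** * Szpilrajn's theorem for preorders *)

(** The Boolean-valued Zorn lemma for preorders, transported to [Prop]. *)
Lemma zorn_preorder (A : Type) (R : relation A) (a : A) :
  preorder A R ->
  (forall C : A -> Prop, (forall s t, C s -> C t -> R s t \/ R t s) ->
    exists t, forall s, C s -> R s t) ->
  exists m, forall s, R m s -> R s m.
Proof.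
  intros [Rrefl Rtrans] Rchain.
  destruct (@classical_sets.ZL_preorder A a (fun s t => boolp.asbool (R s t)))
    as [m Hm].
  - intros t. apply boolp.asboolT, Rrefl.
  - intros r s t Hrs Hst. apply boolp.asboolT.
    exact (Rtrans _ _ _ (boolp.asboolW Hrs) (boolp.asboolW Hst)).
  - intros C HC. destruct (Rchain C) as [t Ht].
    + intros s t Cs Ct.
      destruct (HC s t Cs Ct) as [H|H]; apply boolp.asboolW in H; auto.
    + exists t. intros s Cs. apply boolp.asboolT, Ht, Cs.
  - exists m. intros s Hms. apply boolp.asboolW, Hm, boolp.asboolT, Hms.
Qed.

(** The least preorder containing the preorder [Q] and the pair [(a, b)]: a path
    using the new pair can be shortcut to use it only once. *)
Definition add_pair (X : Type) (Q : relation X) (a b : X) : relation X :=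
  fun x y => Q x y \/ (Q x a /\ Q b y).

Lemma preorder_add_pair (X : Type) (Q : relation X) (a b : X) :
  preorder X Q -> preorder X (add_pair Q a b).
Proof.
  intros [Qrefl Qtrans]. split.
  - intros x. left. apply Qrefl.
  - intros x y z [Hxy|[Hxa Hby]] [Hyz|[Hya Hbz]].
    + left. eauto.
    + right. eauto.
    + right. eauto.
    + right. eauto.
Qed.

(** A new indifference would be a loop through the new pair, whose return part
    would be a [Q]-path from [b] to [a]. *)
Lemma sym_part_add_pair (X : Type) (Q : relation X) (a b : X) :
  preorder X Q -> ~ Q b a ->
  inclusion X (sym_part (add_pair Q a b)) (sym_part Q).
Proof.
  intros [Qrefl Qtrans] Hba x y [[Hxy|[Hxa Hby]] [Hyx|[Hya Hbx]]].
  - split; assumption.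
  - exfalso. eauto.
  - exfalso. eauto.
  - exfalso. eauto.
Qed.

Definition preorder_refinement (X : Type) (R Q : relation X) : Prop :=
  preorder X Q /\ inclusion X R Q /\ inclusion X (sym_part Q) (sym_part R).

Lemma preorder_refinement_chain_union (X : Type) (R : relation X)
    (C : relation X -> Prop) (Q0 : relation X) :
  C Q0 -> (forall Q, C Q -> preorder_refinement R Q) ->
  (forall Q Q', C Q -> C Q' -> inclusion X Q Q' \/ inclusion X Q' Q) ->
  preorder_refinement R (fun x y => exists Q, C Q /\ Q x y).
Proof.
  intros CQ0 HC Hchain.
  (* Transitivity and the control of indifferences each involve only two pairs,
     and any two pairs already belong to a common member of the chain. *)
  assert (Hcommon : forall x y z w,
    (exists Q, C Q /\ Q x y) -> (exists Q, C Q /\ Q z w) ->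
    exists Q, C Q /\ Q x y /\ Q z w).
  { intros x y z w [Q [CQ Qxy]] [Q' [CQ' Qzw]].
    destruct (Hchain Q Q' CQ CQ') as [H|H].
    - exists Q'. auto.
    - exists Q. auto. }
  split; [split|split].
  - intros x. exists Q0. split; [assumption|].
    destruct (HC Q0 CQ0) as [[Qrefl _] _]. apply Qrefl.
  - intros x y z Hxy Hyz.
    destruct (Hcommon x y y z Hxy Hyz) as [Q [CQ [Qxy Qyz]]].
    exists Q. split; [assumption|].
    destruct (HC Q CQ) as [[_ Qtrans] _]. eauto.
  - intros x y Rxy. exists Q0. split; [assumption|].
    destruct (HC Q0 CQ0) as [_ [HR _]]. auto.
  - intros x y [Hxy Hyx].
    destruct (Hcommon x y y x Hxy Hyx) as [Q [CQ [Qxy Qyx]]].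
    destruct (HC Q CQ) as [_ [_ Hsym]]. apply Hsym. split; assumption.
Qed.

(** Take a maximal refinement [T]. If it does not relate [b] to [a], then adding
    the pair [(a, b)] gives a refinement again, so by maximality the pair was
    already in [T]. *)
Lemma total_preorder_refinement (X : Type) (R : relation X) :
  preorder X R -> exists T, preorder_refinement R T /\ total T.
Proof.
  intros HR.
  assert (HRR : preorder_refinement R R).
  { split; [assumption|]. split; intros x y Hxy; exact Hxy. }
  destruct (@zorn_preorder {Q | preorder_refinement R Q}
    (fun Q Q' => inclusion X (proj1_sig Q) (proj1_sig Q')) (exist _ R HRR))
    as [[T HT] Hmax].
  - split.
    + intros Q x y Hxy. exact Hxy.
    + intros Q Q' Q'' H H' x y Hxy. apply H', H, Hxy.
  - intros C HC.
    (* The union of the empty chain is not reflexive, hence the case split. *)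
    destruct (classic (exists Q, C Q)) as [[[Q0 HQ0] CQ0]|Hempty].
    + pose (D Q := exists H : preorder_refinement R Q, C (exist _ Q H)).
      assert (HU : preorder_refinement R (fun x y => exists Q, D Q /\ Q x y)).
      { apply preorder_refinement_chain_union with Q0.
        - exists HQ0. exact CQ0.
        - intros Q [HQ _]. exact HQ.
        - intros Q Q' [HQ CQ] [HQ' CQ']. exact (HC _ _ CQ CQ'). }
      exists (exist _ _ HU). intros [Q HQ] CQ x y Qxy. simpl in *.
      exists Q. split; [exists HQ|]; assumption.
    + exists (exist _ R HRR). intros Q CQ. exfalso. eauto.
  - exists T. split; [assumption|]. intros a b.
    destruct (classic (T b a)) as [Hba|Hba]; [right; assumption|left].
    destruct HT as [HTpre [HRT Hsym]].
    assert (HT' : preorder_refinement R (add_pair T a b)).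
    { split; [|split].
      - apply preorder_add_pair; assumption.
      - intros x y Rxy. left. auto.
      - intros x y Hxy. apply Hsym.
        exact (sym_part_add_pair HTpre Hba Hxy). }
    apply (Hmax (exist _ _ HT')); simpl.
    + intros x y Txy. left. assumption.
    + right. split; apply (preord_refl _ _ HTpre).
Qed.

(** * Acyclicity *)

Lemma clos_trans_chain (X : Type) (G : relation X) (x y : X) :
  clos_trans X G x y ->
  exists (n : nat) (f : nat -> X), 1 <= n /\ f 1 = x /\
    (forall i, 1 <= i < n -> G (f i) (f (i + 1))) /\ G (f n) y.
Proof.
  intros Hxy. apply clos_trans_tn1 in Hxy.
  induction Hxy as [y Gxy|y z Gyz _ [n [f [Hn [Hf1 [Hstep Hlast]]]]]].
  - exists 1, (fun _ => x). repeat split; auto. intros i Hi. lia.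
  - exists (n + 1), (fun i => if i <=? n then f i else y).
    split; [lia|]. split; [|split].
    + destruct (Nat.leb_spec 1 n); [assumption|lia].
    + intros i Hi.
      destruct (Nat.leb_spec i n); [|lia].
      destruct (Nat.leb_spec (i + 1) n).
      * apply Hstep. lia.
      * replace i with n by lia. assumption.
    + destruct (Nat.leb_spec (n + 1) n); [lia|assumption].
Qed.

Lemma acyclic_clos_trans_irrefl (X : Type) (G : relation X) (x : X) :
  acyclic G -> ~ clos_trans X G x x.
Proof.
  intros HG Hxx.
  destruct (clos_trans_chain Hxx) as [n [f [Hn [Hf1 [Hstep Hlast]]]]].
  apply (HG n f Hn Hstep). rewrite Hf1. assumption.
Qed.

(** Transitivity carries [T] from the first to the last element of a chain, and
    the step closing a cycle would be strict in the opposite direction. *)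
Lemma strict_in_preorder_acyclic (X : Type) (G T : relation X) :
  preorder X T -> inclusion X G (asym_part T) -> acyclic G.
Proof.
  intros [Trefl Ttrans] HG n f Hn Hstep Hclose.
  apply (proj2 (HG _ _ Hclose)).
  assert (Hup : forall k, 1 <= k <= n -> T (f 1) (f k)).
  { induction k as [|k IHk]; intros Hk; [lia|].
    destruct (Nat.eq_dec k 0) as [->|Hk0]; [apply Trefl|].
    apply Ttrans with (f k); [apply IHk; lia|].
    replace (S k) with (k + 1) by lia.
    apply HG, Hstep. lia. }
  apply Hup. lia.
Qed.

(** * Composing a relation with an equivalence on both sides *)

Section Composition.
Variables (X : Type) (S P : relation X).
Hypothesis hS : equivalence X S.

Let B : relation X := rel_comp (rel_comp S P) S.

Lemma composition_intro : inclusion X P B.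
Proof.
  destruct hS as [Srefl _ _]. intros x y Pxy.
  exists y. split; [|apply Srefl]. exists x. auto.
Qed.

Lemma clos_trans_composition_absorb_left (x y z : X) :
  S x y -> clos_trans X B y z -> clos_trans X B x z.
Proof.
  destruct hS as [Srefl Strans Ssym]. intros Sxy Hyz. revert x Sxy.
  induction Hyz as [y z [v [[u [Syu Puv]] Svz]]|y w z _ IHyw Hwz _];
    intros x Sxy.
  - apply t_step. exists v. split; [|assumption].
    exists u. split; [|assumption]. eauto.
  - apply t_trans with w; [apply IHyw|]; assumption.
Qed.

Lemma clos_trans_composition_absorb_right (x y z : X) :
  clos_trans X B x y -> S y z -> clos_trans X B x z.
Proof.
  destruct hS as [Srefl Strans Ssym]. intros Hxy. revert z.
  induction Hxy as [x y [v [[u [Sxu Puv]] Svy]]|x w y Hxw _ _ IHwy];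
    intros z Syz.
  - apply t_step. exists v. split; [|eauto].
    exists u. split; assumption.
  - apply t_trans with w; [|apply IHwy]; assumption.
Qed.

(** The least preorder containing [S] and [P]. Keeping [S] apart from the
    transitive closure, rather than closing their union, lets its symmetric part
    be read off. *)
Definition composed_preorder : relation X := union X S (clos_trans X B).

Lemma preorder_composed_preorder : preorder X composed_preorder.
Proof.
  destruct hS as [Srefl Strans Ssym]. split.
  - intros x. left. apply Srefl.
  - intros x y z [Sxy|Bxy] [Syz|Byz].
    + left. eauto.
    + right. exact (clos_trans_composition_absorb_left Sxy Byz).
    + right. exact (clos_trans_composition_absorb_right Bxy Syz).
    + right. exact (t_trans _ _ _ _ _ Bxy Byz).
Qed.

(** A two-way relation involving [B+] closes up, after absorption of [S], to
    a [B+]-loop. *)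
Lemma sym_part_composed_preorder :
  acyclic B -> same_relation X (sym_part composed_preorder) S.
Proof.
  intros HB. split.
  - intros x y [[Sxy|Bxy] [Syx|Byx]]; [assumption| | |];
      exfalso; apply (acyclic_clos_trans_irrefl (x := x) HB).
    + exact (clos_trans_composition_absorb_left Sxy Byx).
    + exact (clos_trans_composition_absorb_right Bxy Syx).
    + exact (t_trans _ _ _ _ _ Bxy Byx).
  - intros x y Sxy. split; left; [assumption|].
    apply (equiv_sym _ _ hS). assumption.
Qed.

(** If a [P]-step joined [S]-equivalent elements, returning by [S] would make
    a [B]-loop. *)
Lemma composition_acyclic_disjoint (x y : X) : acyclic B -> P x y -> ~ S x y.
Proof.
  intros HB Pxy Sxy.
  apply (acyclic_clos_trans_irrefl (x := x) HB).
  apply clos_trans_composition_absorb_right with y.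
  - apply t_step, composition_intro, Pxy.
  - apply (equiv_sym _ _ hS), Sxy.
Qed.

(** The indifferences in [S] on either side do not affect strictness. *)
Lemma composition_strict (T : relation X) :
  preorder X T -> inclusion X P (asym_part T) ->
  inclusion X S T -> inclusion X B (asym_part T).
Proof.
  destruct hS as [Srefl Strans Ssym].
  intros [Trefl Ttrans] HP HS x y [v [[u [Sxu Puv]] Svy]].
  destruct (HP _ _ Puv) as [Tuv Hvu]. split.
  - apply Ttrans with u; [auto|]. apply Ttrans with v; auto.
  - intros Tyx. apply Hvu.
    apply Ttrans with y; [auto|]. apply Ttrans with x; auto.
Qed.

End Composition.

(** * The extension theorem *)

Theorem theorem5 (X : Type) (S le : relation X)
  (hX : inhabited X) (hS : equivalence X S) (hle : order X le) :
  (exists T : relation X, total_preorder_extension S le T)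
  <-> acyclic (rel_comp (rel_comp S (asym_part le)) S).
Proof.
  split.
  - intros [T [[HT _] [HP [_ HS]]]].
    apply (strict_in_preorder_acyclic HT).
    apply composition_strict; try assumption.
    intros x y Sxy. apply (HS _ _ Sxy).
  - intros HB.
    destruct (total_preorder_refinement
                (preorder_composed_preorder (asym_part le) hS))
      as [T [[HT [Hincl Hsym]] Htot]].
    destruct (sym_part_composed_preorder hS HB) as [HsymS HSsym].
    assert (HTS : inclusion X (sym_part T) S).
    { intros x y Hxy. apply HsymS, Hsym, Hxy. }
    assert (HPT : inclusion X (asym_part le) T).
    { intros x y Pxy. apply Hincl. right.
      apply t_step, composition_intro; assumption. }
    exists T. split; [split; assumption|]. split; [|split].
    + intros x y Pxy. split; [apply HPT, Pxy|].
      intros Tyx. apply (composition_acyclic_disjoint hS _ _ HB Pxy).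
      apply HTS. split; [apply HPT, Pxy|assumption].
    + exact HTS.
    + intros x y Sxy. destruct (HSsym _ _ Sxy) as [Hxy Hyx].
      split; apply Hincl; assumption.
Qed.
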